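(* Let $K=\mathbb{C}\{\{t\}\}$, let $U\subseteq K^{\mathcal{J}}$ be an $n$-dimensional totally isotropic subspace, and let $L\subseteq\mathbb{T}^{\mathcal{J}}$ be its tropicalization (an $n$-dimensional isotropical linear space). Let $p\in\mathbb{T}^{\mathcal{P}([n])}$ be the tropical Wick vector obtained as the valuation of the Wick coordinate vector $w$ of $U$. Then the set of admissible vectors in $L$ equals the cocycle space $\mathcal{Q}(p)\subseteq\mathbb{T}^{\mathcal{J}}$.
   Context: $\mathbb{T}=\mathbb{R}\cup\{\infty\}$; $K=\mathbb{C}\{\{t\}\}$ is the field of Puiseux series with valuation $\operatorname{val}$ (least exponent; $\operatorname{val}(0)=\infty$). $\mathcal{J}=\{1,\dots,n,1^*,\dots,n^*\}$ with involution $i\leftrightarrow i^*$. A subspace $U\subseteq K^{\mathcal{J}}$ is totally isotropic if $\sum_{i=1}^n(x_iy_{i^*}+x_{i^*}y_i)=0$ for all $x,y\in U$. Wick coordinates: for such $U$ of dimension $n$ there is $J\subseteq[n]$ such that after swapping coordinates $j\leftrightarrow j^*$ for $j\in J$, $U$ is the row space of a matrix $[I\mid A]$ with $A$ an $n\times n$ skew-symmetric matrix; then $w\in\mathbb{P}^{2^n-1}(K)$ has $w_{[n]\setminus S}=\pm\operatorname{Pf}(A_{S\Delta J})$ if $|S\Delta J|$ is even and $0$ otherwise ($A_X$ the principal submatrix on rows/columns $X$, $\operatorname{Pf}$ of the empty matrix $=1$), well defined up to scalar. Its valuation $p$, $p_S=\operatorname{val}(w_S)$, is defined up to adding a constant.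 The tropicalization of $U$ is $\bigcap_{P}\operatorname{Trop}(\operatorname{trop}(P))$ over all polynomials $P\in K[X_j:j\in\mathcal{J}]$ vanishing on $U$, where $\operatorname{trop}(\sum_af_aX^a)(x)=\min_a(\operatorname{val}(f_a)+a\cdot x)$ and $\operatorname{Trop}$ of it is the set of $x\in\mathbb{T}^{\mathcal{J}}$ at which the minimum is attained at least twice or equals $\infty$. A tropical Wick vector is $p$ such that for all $S,T\subseteq[n]$ the minimum $\min_{i\in S\Delta T}(p_{S\Delta\{i\}}+p_{T\Delta\{i\}})$ is attained at least twice or equals $\infty$. $X\subseteq\mathcal{J}$ is admissible if $X\cap X^*=\emptyset$; a vector is admissible if its support (coordinates $\neq\infty$) is admissible. For $S\subseteq[n]$ let $\bar S=S\cup\{i^*:i\in[n]\setminus S\}$, $\bar p_{\bar S}:=p_S$; for $T\subseteq[n]$, $(c_T)_i=\bar p_{\bar T\Delta\{i,i^*\}}$ if $i\in\bar T$, $\infty$ otherwise. Circuits of $p$: $c_T+\lambda\mathbf{1}$ ($\lambda\in\mathbb{R}$) with nonempty support. $x,y$ are tropically orthogonal if $\min_k(x_k+y_k)$ is attained at least twice or equals $\infty$. The cocycle space $\mathcal{Q}(p)$ is the set of admissible vectors tropically orthogonal to all circuits of $p$. *)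

(* Defs.v *)
From HB Require Import structures.
From mathcomp Require Import all_boot all_order all_algebra.
From mathcomp Require Import boolp classical_sets fsbigop.
From mathcomp Require Import complex.
From mathcomp Require Import Rstruct.
From Stdlib Require Rdefinitions.
Notation R := Rdefinitions.R.

Set Implicit Arguments.
Unset Strict Implicit.
Unset Printing Implicit Defensive.
Import Order.TTheory GRing.Theory Num.Theory.
Local Open Scope ring_scope.

(* A Puiseux series is a coefficient function rat -> C whose support    *)
(* is bounded below and contained in (1/N)Z for some N > 0.            *)
(* Elements of K are represented by such functions (predicate          *)
(* [puiseux]); equality is equality of coefficient functions.          *)
Definition CC := complex R.
Definition Kt := rat -> CC.

Definition puiseux (f : Kt) : Prop :=
  exists (N : nat) (a : rat), (0 < N)%N /\
    forall q, f q != 0 -> a <= q /\ exists z : int, q * N%:R = z%:~R.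

Definition kzero : Kt := fun _ => 0.
Definition kone : Kt := fun q => if q == 0 then 1 else 0.
Definition kadd (f g : Kt) : Kt := fun q => f q + g q.
Definition kopp (f : Kt) : Kt := fun q => - f q.
(* Cauchy product: the sum has finite support for Puiseux series. *)
Definition kmul (f g : Kt) : Kt :=
  fun q => (\sum_(r \in [set: rat]) f r * g (q - r))%R.
Definition ksum (s : seq Kt) : Kt := foldr kadd kzero s.
Definition kprod (s : seq Kt) : Kt := foldr kmul kone s.
Definition kpow (f : Kt) (k : nat) : Kt := iter k (kmul f) kone.

(* Tropical numbers T = R u {oo}, encoded as option R (None = oo).      *)
Definition trop := option R.
Definition tadd (x y : trop) : trop :=
  match x, y with Some a, Some b => Some (a + b) | _, _ => None end.
Definition tle (x y : trop) : bool :=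
  match x, y with
  | _, None => true
  | None, Some _ => false
  | Some a, Some b => (a <= b)%R
  end.
(* a * x for a natural exponent a (with 0 * x = 0, the monomial does not
   involve the variable). *)
Definition tnsmul (a : nat) (x : trop) : trop :=
  if a == 0%N then Some 0 else
  match x with Some r => Some (a%:R * r) | None => None end.
Definition tsum (s : seq trop) : trop := foldr tadd (Some 0) s.

Definition min_twice (s : seq trop) : Prop :=
  (forall t, t \in s -> t = None) \/
  exists i j, (i < size s)%N /\ (j < size s)%N /\ i <> j /\
    nth None s i = nth None s j /\ nth None s i <> None /\
    forall t, t \in s -> tle (nth None s i) t.

Definition kval (f : Kt) : trop :=
  match pselect (exists q, f q != 0 /\ forall r, f r != 0 -> q <= r) with
  | left H => Some (ratr (proj1_sig (cid H)))
  | right _ => None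
  end.

(* Index set J = {1..n, 1*..n*}: inl i = i, inr i = i*.                 *)
Definition Jidx (n : nat) : finType := ('I_n + 'I_n)%type.
Definition star n (e : Jidx n) : Jidx n :=
  match e with inl i => inr i | inr i => inl i end.

Definition vecK n := Jidx n -> Kt.
Definition vzero n : vecK n := fun _ => kzero.

Definition lincomb n d (c : 'I_d -> Kt) (b : 'I_d -> vecK n) : vecK n :=
  fun e => ksum [seq kmul (c i) (b i e) | i <- enum 'I_d].

Definition has_dim n (U : vecK n -> Prop) (d : nat) : Prop :=
  exists b : 'I_d -> vecK n,
    (forall i e, puiseux (b i e)) /\
    (forall x, U x <-> exists c : 'I_d -> Kt,
                 (forall i, puiseux (c i)) /\ x = lincomb c b) /\
    (forall c : 'I_d -> Kt, (forall i, puiseux (c i)) ->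
        lincomb c b = @vzero n -> forall i, c i = kzero).

Definition totally_isotropic n (U : vecK n -> Prop) : Prop :=
  forall x y, U x -> U y ->
    ksum [seq kadd (kmul (x (inl i)) (y (inr i))) (kmul (x (inr i)) (y (inl i)))
         | i <- enum 'I_n] = kzero.

Definition skewK n (A : 'I_n -> 'I_n -> Kt) : Prop :=
  (forall i j, puiseux (A i j)) /\ (forall i j, A i j = kopp (A j i)).

Definition rowIA n (A : 'I_n -> 'I_n -> Kt) (i : 'I_n) : vecK n :=
  fun e => match e with
           | inl k => if i == k then kone else kzero
           | inr k => A i k
           end.

Definition swapJ n (J : {set 'I_n}) (e : Jidx n) : Jidx n :=
  match e with
  | inl k => if k \in J then inr k else inl k
  | inr k => if k \in J then inl k else inr k
  end.

Definition wick_rep n (U : vecK n -> Prop) (J : {set 'I_n})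
    (A : 'I_n -> 'I_n -> Kt) : Prop :=
  skewK A /\
  forall x, U x <-> exists c : 'I_n -> Kt, (forall i, puiseux (c i)) /\
                    (fun e => x (swapJ J e)) = lincomb c (rowIA A).

Definition rem_at (T : Type) (k : nat) (s : seq T) := take k s ++ drop k.+1 s.
Definition ksign (k : nat) (f : Kt) : Kt := if odd k then kopp f else f.

(* Pfaffian of the principal submatrix on the index list l (expansion
   along the first row); Pf of the empty matrix is 1. *)
Fixpoint pf_aux n (A : 'I_n -> 'I_n -> Kt) (fuel : nat) (l : seq 'I_n) : Kt :=
  match l with
  | [::] => kone
  | i :: rest =>
      match fuel with
      | 0 => kzero
      | fuel'.+1 =>
          ksum [seq ksign k (kmul (A i (nth i rest k))
                                  (pf_aux A fuel' (rem_at k rest)))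
               | k <- iota 0 (size rest)]
      end
  end.
Definition pfaff n (A : 'I_n -> 'I_n -> Kt) (X : {set 'I_n}) : Kt :=
  pf_aux A #|X| (enum X).

Definition symdiff (T : finType) (X Y : {set T}) : {set T} :=
  (X :\: Y) :|: (Y :\: X).

(* p = val(w): p_{[n]\S} = val(Pf(A_{S Delta J})) if |S Delta J| even,
   oo otherwise (the sign of w does not affect the valuation). *)
Definition wickval n (A : 'I_n -> 'I_n -> Kt) (J : {set 'I_n})
    (T : {set 'I_n}) : trop :=
  let X := symdiff (~: T) J in
  if odd #|X| then None else kval (pfaff A X).

Definition polyK n := seq (Kt * {ffun Jidx n -> nat}).
Fixpoint coefs_puiseux n (P : polyK n) : Prop :=
  match P with [::] => True | t :: P' => puiseux t.1 /\ coefs_puiseux P' end.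
Definition wf_poly n (P : polyK n) : Prop :=
  uniq [seq t.2 | t <- P] /\ coefs_puiseux P.

Definition evalK n (P : polyK n) (x : vecK n) : Kt :=
  ksum [seq kmul t.1 (kprod [seq kpow (x j) (t.2 j) | j <- enum (Jidx n)])
       | t : Kt * {ffun Jidx n -> nat} <- P].

Definition trop_terms n (P : polyK n) (x : Jidx n -> trop) : seq trop :=
  [seq tadd (kval t.1) (tsum [seq tnsmul (t.2 j) (x j) | j <- enum (Jidx n)])
  | t : Kt * {ffun Jidx n -> nat} <- P].

Definition tropicalization n (U : vecK n -> Prop) (x : Jidx n -> trop) : Prop :=
  forall P : polyK n, wf_poly P -> (forall y, U y -> evalK P y = kzero) ->
    min_twice (trop_terms P x).

Definition admissible n (x : Jidx n -> trop) : Prop :=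
  forall e, ~ (x e <> None /\ x (star e) <> None).

Definition barset n (S : {set 'I_n}) : {set Jidx n} :=
  [set e | match e with inl i => i \in S | inr i => i \notin S end].
(* bar p_{bar S} := p_S *)
Definition pbar n (p : {set 'I_n} -> trop) (Y : {set Jidx n}) : trop :=
  p [set i | inl i \in Y].

Definition circ_vec n (p : {set 'I_n} -> trop) (T : {set 'I_n}) :
    Jidx n -> trop :=
  fun e => if e \in barset T
           then pbar p (symdiff (barset T) [set e; star e]) else None.

Definition is_circuit n (p : {set 'I_n} -> trop) (c : Jidx n -> trop) : Prop :=
  exists (T : {set 'I_n}) (lam : R),
    (exists e, circ_vec p T e <> None) /\
    c = (fun e => tadd (circ_vec p T e) (Some lam)).

Definition trop_orth n (x y : Jidx n -> trop) : Prop :=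
  min_twice [seq tadd (x e) (y e) | e <- enum (Jidx n)].

Definition cocycle_space n (p : {set 'I_n} -> trop) (x : Jidx n -> trop) : Prop :=
  admissible x /\ forall c, is_circuit p c -> trop_orth x c.

(* Main.v *)
(* Write p for the valuation of the Wick vector. For every T, row expansions of
   sub-Pfaffians give a vector V_T of U whose coordinate at star e has valuation
   c_T(e). By isotropy, the form with coefficients V_T(star e) vanishes on U, so a
   point of the tropicalization is orthogonal to every circuit.

   Conversely let x be a cocycle with support D, and suppose that some P
   vanishing on U has a single minimal term at x. Finitely many signs of rational
   affine forms in x matter, so x may be taken rational. Among the T with p_T
   finite that minimize the size of B = \bar T /\ D, choose one minimizing
   p_T - sum_(b in B) x_b. Then a generic combination u of the vectors
   t^(x_b - p_T) V_(T delta b), b in B, vanishes outside D (minimality of |B|) and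
   has valuation at least x on D (minimality of the weight); orthogonality to
   the circuits c_(T delta j), j in D, gives for each coordinate a leading
   coefficient that is a nonzero linear form in the parameters. So val u = x with
   u in U, and P(u) <> 0, a contradiction. *)
Require Import Defs.
From HB Require Import structures.
From mathcomp Require Import all_boot all_order all_algebra.
From mathcomp Require Import boolp classical_sets fsbigop.
From mathcomp Require Import reals complex Rstruct.
From mathcomp Require Import ring lra zify.

Set Implicit Arguments.
Unset Strict Implicit.
Unset Printing Implicit Defensive.
Import Order.TTheory GRing.Theory Num.Theory.
Local Open Scope classical_set_scope.
Local Open Scope ring_scope.

(** * The ring of Puiseux series *)

Lemma kmulE (f g : Kt) q (s : seq rat) : uniq s ->
  (forall r, f r != 0 -> g (q - r) != 0 -> r \in s) ->
  kmul f g q = \sum_(r <- s) f r * g (q - r).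
Proof.
move=> us hs; rewrite /kmul [RHS]fsbig_seq //.
apply: esym; apply: (fsbig_widen [set` s] [set: rat]) => //= r [_ h].
apply/eqP; apply: contraT; rewrite mulf_eq0 negb_or => /andP[h1 h2].
by case: h; rewrite /=; apply: hs.
Qed.

Lemma kmul_neq0 (f g : Kt) q : kmul f g q != 0 ->
  exists r, f r != 0 /\ g (q - r) != 0.
Proof.
move=> h; apply: contrapT => hn; case/eqP: h.
rewrite (kmulE (s := [::])) ?big_nil // => r h1 h2.
by case: hn; exists r.
Qed.

(** Supplies the lists for [kmulE]: at a fixed exponent of a product, the lower bound of one factor
    bounds the exponents of the other from above. *)
Lemma finite_grid (N : nat) (a b : rat) : exists s : seq rat, uniq s /\
  forall q, (exists z : int, q * N.+1%:R = z%:~R) -> a <= q -> q <= b -> q \in s.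
Proof.
(* [M] bounds both scaled endpoints in absolute value; shifting by [M] turns the integers between
   them into naturals. *)
pose M := (Num.bound `|a * N.+1%:R|%R + Num.bound `|b * N.+1%:R|%R)%N.
exists (undup [seq (k%:Z - M%:Z)%:~R / N.+1%:R | k <- iota 0 (M + M).+1]).
split=> [|q [z qz] aq qb]; first exact: undup_uniq.
have N0 : (0 : rat) < N.+1%:R by rewrite ltr0n.
have Mb (c : rat) : (Num.bound `|c * N.+1%:R|%R <= M)%N -> `|c * N.+1%:R| <= M%:R.
  move=> h; apply: le_trans (ltW (archi_boundP (normr_ge0 _))) _.
  by rewrite ler_nat.
have /ler_normlP[ha _] : `|a * N.+1%:R| <= M%:R by apply: Mb; rewrite leq_addr.
have /ler_normlP[_ hb] : `|b * N.+1%:R| <= M%:R by apply: Mb; rewrite leq_addl.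
have z1 : (- M%:Z <= z)%R.
  rewrite -(ler_int rat) -qz rmorphN /= -pmulrn lerNl (le_trans _ ha) // lerN2.
  by rewrite ler_pM2r.
have z2 : (z <= M%:Z)%R.
  by rewrite -(ler_int rat) -qz -pmulrn (le_trans _ hb) // ler_pM2r.
rewrite mem_undup; apply/mapP; exists (absz (z + M%:Z)).
  by rewrite mem_iota; lia.
rewrite gez0_abs; last by lia.
by rewrite addrK -qz mulfK // gt_eqF.
Qed.

Definition kdom (N : nat) (a : rat) (f : Kt) := forall q, f q != 0 ->
  a <= q /\ exists z : int, q * N.+1%:R = z%:~R.

Lemma puiseuxP f : puiseux f <-> exists N a, kdom N a f.
Proof.
split=> [[[|N] [a [] // _ h]]|[N [a h]]]; first by exists N, a.
by exists N.+1, a.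
Qed.

(** The product of two denominators is a common one. Both orders are stated so that two series can
    be brought to the same domain; the predecessor undoes the successor built into [kdom]. *)
Lemma kdom_widen N N' a a' f : a' <= a -> kdom N a f ->
  kdom (N.+1 * N'.+1).-1 a' f /\ kdom (N'.+1 * N.+1).-1 a' f.
Proof.
move=> aa h; rewrite mulnC; split=> q /h[aq [z qz]];
(split; first exact: le_trans aq); exists (z * N'.+1%:Z);
by rewrite prednK ?muln_gt0 // natrM mulrCA qz rmorphM /= mulrC.
Qed.

Lemma common_kdom (f g : Kt) : puiseux f -> puiseux g ->
  exists N a, kdom N a f /\ kdom N a g.
Proof.
move=> /puiseuxP[N [a fh]] /puiseuxP[M [b gh]].
exists (N.+1 * M.+1).-1, (Num.min a b); split.
  by apply: (kdom_widen _ _ fh).1; rewrite ge_min lexx.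
by apply: (kdom_widen _ _ gh).2; rewrite ge_min lexx orbT.
Qed.

Lemma kdom_puiseux N a f : kdom N a f -> puiseux f.
Proof. by move=> h; apply/puiseuxP; exists N, a. Qed.

Lemma kdom0 N a : kdom N a kzero.
Proof. by move=> q; rewrite eqxx. Qed.

Lemma kdom1 : kdom 0 0 kone.
Proof.
move=> q; rewrite /kone; case: (q =P 0) => [-> _|]; last by rewrite eqxx.
by split=> //; exists 0; rewrite mul0r.
Qed.

Lemma kdomD N a f g : kdom N a f -> kdom N a g -> kdom N a (kadd f g).
Proof.
move=> hf hg q; rewrite /kadd; case: (eqVneq (f q) 0) => [->|]; last by move=> /hf.
by rewrite add0r => /hg.
Qed.

Lemma kdomN N a f : kdom N a f -> kdom N a (kopp f).
Proof. by move=> hf q; rewrite /kopp oppr_eq0 => /hf. Qed.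

Lemma kdomM N a b f g : kdom N a f -> kdom N b g -> kdom N (a + b) (kmul f g).
Proof.
move=> hf hg q /kmul_neq0[r [/hf[h1 [z hz]] /hg[h2 [y hy]]]]; split; first lra.
by exists (z + y); rewrite rmorphD /= -hz -hy; ring.
Qed.

Lemma kmulC (f g : Kt) : puiseux f -> puiseux g -> kmul f g = kmul g f.
Proof.
move=> pf pg; have [N [a [hf hg]]] := common_kdom pf pg.
apply/funext => q; have [s [us hs]] := finite_grid N a (q - a).
rewrite (kmulE us); last by move=> r /hf[h1 h2] /hg[h3 _]; apply: hs => //; lra.
rewrite (kmulE (s := [seq q - r | r <- s])).
- by rewrite big_map; apply: eq_bigr => r _; rewrite subKr mulrC.
- by rewrite map_inj_uniq // => x y /addrI/oppr_inj.
move=> r /hg[h1 _] /hf[h3 h4]; apply/mapP; exists (q - r).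
  by apply: hs => //; lra.
by rewrite subKr.
Qed.

Lemma kmulDl (f g h : Kt) : puiseux f -> puiseux g -> puiseux h ->
  kmul (kadd f g) h = kadd (kmul f h) (kmul g h).
Proof.
move=> pf pg /puiseuxP[M [c hh]]; have [N [a [hf hg]]] := common_kdom pf pg.
apply/funext => q; have [s [us hs]] := finite_grid N a (q - c).
have ms r : (a <= r /\ exists z : int, r * N.+1%:R = z%:~R) -> h (q - r) != 0 ->
  r \in s by move=> [h1 h2] /hh[h3 _]; apply: hs => //; lra.
rewrite /kadd !(kmulE us); first (rewrite -big_split; apply: eq_bigr => r _; exact: mulrDl).
- by move=> r /hg; apply: ms.
- by move=> r /hf; apply: ms.
- by move=> r /(kdomD hf hg); apply: ms.
Qed.

(** Both sides equal one double sum over exponents r of f and w of the product of f and g, the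
    exponent of g being w - r. *)
Lemma kmulA (f g h : Kt) : puiseux f -> puiseux g -> puiseux h ->
  kmul f (kmul g h) = kmul (kmul f g) h.
Proof.
move=> pf pg /puiseuxP[M [c hh]]; have [N [a [hf hg]]] := common_kdom pf pg.
apply/funext => q.
have [s [us hs]] := finite_grid N a (q - a - c).
have [t [ut ht]] := finite_grid N (a + a) (q - c).
rewrite (kmulE us); last first.
  move=> r /hf[h1 h2] /kmul_neq0[r' [/hg[h3 _] /hh[h4 _]]]; apply: hs => //; lra.
rewrite (kmulE ut); last first.
  move=> r /(kdomM hf hg)[h1 h2] /hh[h3 _]; apply: ht => //; lra.
transitivity (\sum_(r <- s) \sum_(w <- t) f r * (g (w - r) * h (q - w))).
  apply: eq_bigr => r _; rewrite -mulr_sumr.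
  (* For r in the support of f, r lies on the grid, so translation by r carries the relevant
     exponents of g into [t]. *)
  have [->|/hf[fr [z hz]]] := eqVneq (f r) 0; first by rewrite !mul0r.
  congr (_ * _); rewrite (kmulE (s := [seq w - r | w <- t])).
  - rewrite big_map; apply: eq_bigr => w _; congr (_ * h _); ring.
  - by rewrite map_inj_uniq // => x y /addIr.
  move=> w /hg[h1 [y hy]] /hh[h3 _]; apply/mapP; exists (w + r); last by rewrite addrK.
  apply: ht; [|lra|lra].
  by exists (y + z); rewrite rmorphD /= -hz -hy; ring.
rewrite exchange_big; apply: eq_bigr => w _ /=.
under eq_bigr do rewrite mulrA.
rewrite -mulr_suml.
have [->|/hh[h1 _]] := eqVneq (h (q - w)) 0; first by rewrite !mulr0.
congr (_ * _); rewrite (kmulE us) // => r /hf[h2 h3] /hg[h4 _].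
by apply: hs => //; lra.
Qed.

Lemma kmul1 (f : Kt) : kmul kone f = f.
Proof.
apply/funext => q; rewrite (kmulE (s := [:: 0])) //.
  by rewrite big_seq1 /kone eqxx mul1r subr0.
by move=> r; rewrite /kone inE; case: (r =P 0) => // _; rewrite eqxx.
Qed.

Identity Coercion fun_of_Kt : Kt >-> Funclass.

(** Bundling the series with its proof gives a type that carries a ring structure, so big operators
    and [ring] apply. *)
Record pser := Pser { ps_fun :> Kt; ps_prop : puiseux ps_fun }.

Lemma ps_inj : injective ps_fun.
Proof.
by move=> [f pf] [g pg] /= e; subst g; rewrite (Prop_irrelevance pf pg).
Qed.

HB.instance Definition _ := gen_eqMixin pser.
HB.instance Definition _ := gen_choiceMixin pser.

Lemma puiseuxD f g : puiseux f -> puiseux g -> puiseux (kadd f g).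
Proof.
by move=> pf pg; have [N [a [hf hg]]] := common_kdom pf pg; apply: kdom_puiseux (kdomD hf hg).
Qed.
Lemma puiseuxM f g : puiseux f -> puiseux g -> puiseux (kmul f g).
Proof.
by move=> pf pg; have [N [a [hf hg]]] := common_kdom pf pg; apply: kdom_puiseux (kdomM hf hg).
Qed.
Lemma puiseuxN f : puiseux f -> puiseux (kopp f).
Proof. by move=> /puiseuxP[N [a h]]; apply: kdom_puiseux (kdomN h). Qed.

Definition ps0 := Pser (kdom_puiseux (kdom0 0 0)).
Definition ps1 := Pser (kdom_puiseux kdom1).
Definition psD (f g : pser) := Pser (puiseuxD (ps_prop f) (ps_prop g)).
Definition psN (f : pser) := Pser (puiseuxN (ps_prop f)).
Definition psM (f g : pser) := Pser (puiseuxM (ps_prop f) (ps_prop g)).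

Lemma psDA : associative psD.
Proof. by move=> f g h; apply: ps_inj; apply/funext => q; apply: addrA. Qed.
Lemma psDC : commutative psD.
Proof. by move=> f g; apply: ps_inj; apply/funext => q; apply: addrC. Qed.
Lemma ps0D : left_id ps0 psD.
Proof. by move=> f; apply: ps_inj; apply/funext => q; apply: add0r. Qed.
Lemma psND : left_inverse ps0 psN psD.
Proof. by move=> f; apply: ps_inj; apply/funext => q; apply: addNr. Qed.

HB.instance Definition _ := GRing.isZmodule.Build pser psDA psDC ps0D psND.

Lemma psMA : associative psM.
Proof. by move=> f g h; apply: ps_inj; apply: kmulA; apply: ps_prop. Qed.
Lemma psMC : commutative psM.
Proof. by move=> f g; apply: ps_inj; apply: kmulC; apply: ps_prop. Qed.
Lemma ps1M : left_id ps1 psM.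
Proof. by move=> f; apply: ps_inj; apply: kmul1. Qed.
Lemma psMDl : left_distributive psM psD.
Proof. by move=> f g h; apply: ps_inj; apply: kmulDl; apply: ps_prop. Qed.
Lemma ps1_neq0 : ps1 != ps0.
Proof.
apply/eqP => /(congr1 (fun f : pser => f 0)); rewrite /= /kone /kzero eqxx.
by move/eqP; rewrite oner_eq0.
Qed.

HB.instance Definition _ := GRing.Zmodule_isComNzRing.Build pser psMA psMC ps1M psMDl ps1_neq0.

Lemma ps_add (f g : pser) : ps_fun (f + g) = kadd f g. Proof. by []. Qed.
Lemma ps_mul (f g : pser) : ps_fun (f * g) = kmul f g. Proof. by []. Qed.
Lemma ps_zero : ps_fun 0 = kzero. Proof. by []. Qed.
Lemma ps_exp (f : pser) k : ps_fun (f ^+ k) = kpow f k.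
Proof. by elim: k => [|k IH] //; rewrite exprS ps_mul IH. Qed.
Lemma ps_sum (I : Type) (s : seq I) (F : I -> pser) :
  ps_fun (\sum_(i <- s) F i) = ksum [seq ps_fun (F i) | i <- s].
Proof. by elim: s => [|i s IH]; rewrite ?big_nil // big_cons ps_add IH. Qed.
Lemma ps_prod (I : Type) (s : seq I) (F : I -> pser) :
  ps_fun (\prod_(i <- s) F i) = kprod [seq ps_fun (F i) | i <- s].
Proof. by elim: s => [|i s IH]; rewrite ?big_nil // big_cons ps_mul IH. Qed.

Lemma ps_coefD (f g : pser) q : (f + g : pser) q = f q + g q. Proof. by []. Qed.
Lemma ps_coef_sum (I : Type) (s : seq I) (F : I -> pser) q :
  (\sum_(i <- s) F i) q = \sum_(i <- s) F i q.
Proof. by elim: s => [|i s IH]; rewrite ?big_nil // !big_cons ps_coefD IH. Qed.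

(** Characteristic zero of the coefficients. It turns antisymmetry of the Pfaffian into vanishing on
    a repeated index. *)
Lemma ps_neg_eq (f : pser) : f = - f -> f = 0.
Proof.
move=> h; apply: ps_inj; apply/funext => q; apply/eqP.
move: (congr1 (fun f : pser => f q) h) => /= /eqP; rewrite -addr_eq0.
by rewrite -mulr2n mulrn_eq0.
Qed.

(** * Valuations and leading coefficients *)

Definition has_val (f : Kt) (q : rat) := f q != 0 /\ forall r, f r != 0 -> q <= r.

Lemma has_val_uniq f q r : has_val f q -> has_val f r -> q = r.
Proof. by move=> [h1 h2] [h3 h4]; apply/eqP; rewrite eq_le h2 // h4. Qed.

Lemma kvalE f q : has_val f q -> kval f = Some (ratr q).
Proof.
move=> h; rewrite /kval; case: pselect => [H|[]]; last by exists q.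
by congr (Some (ratr _)); apply: has_val_uniq h; apply: (svalP (cid H)).
Qed.

Lemma kval_Some f x : kval f = Some x -> exists2 q, has_val f q & x = ratr q.
Proof.
rewrite /kval; case: pselect => // H [<-].
by exists (sval (cid H)) => //; apply: (svalP (cid H)).
Qed.

(** Below a given exponent of the support only finitely many others lie, because they sit on a grid
    and are bounded below; the least of them is the valuation. *)
Lemma has_val_ex (f : pser) : f != 0 -> exists q, has_val f q.
Proof.
move=> f0; have [q fq] : exists q, f q != 0.
  apply: contrapT => h; case/eqP: f0; apply: ps_inj; apply/funext => q.
  by apply/eqP; apply: contrapT => /negP hq; apply: h; exists q.
have [N [a fN]] := (puiseuxP f).1 (ps_prop f).
have [s [us hs]] := finite_grid N a q.
have [m ms] : exists m, m \in [seq r <- s | f r != 0] /\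
    forall r, r \in [seq r <- s | f r != 0] -> m <= r.
  have : q \in [seq r <- s | f r != 0].
    by rewrite mem_filter fq; apply: hs => //; have [] := fN _ fq.
  elim: [seq r <- s | f r != 0] q {fq hs} => // x l IH q _.
  case: l IH => [|y l] IH.
    by exists x; rewrite mem_head; split=> // r; rewrite inE => /eqP ->.
  have [m [ml hm]] := IH y (mem_head _ _).
  exists (Num.min x m); split.
    by rewrite minEle; case: ifP => _; rewrite in_cons ?eqxx // ml orbT.
  move=> r; rewrite in_cons => /orP[/eqP ->|/hm mr]; first by rewrite ge_min lexx.
  by rewrite ge_min mr orbT.
case: ms; rewrite mem_filter => /andP[fm _] hm; exists m; split=> // r fr.
have [rq|qr] := leP r q.
  by apply: hm; rewrite mem_filter fr; apply: hs => //; have [] := fN _ fr.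
apply: le_trans (ltW qr); apply: hm; rewrite mem_filter fq.
by apply: hs => //; have [] := fN _ fq.
Qed.

Lemma kval_None (f : pser) : kval f = None <-> f = 0.
Proof.
split=> [h|->]; last first.
  by rewrite /kval; case: pselect => // -[q []]; rewrite eqxx.
apply/eqP; apply: contrapT => /negP /has_val_ex[q /kvalE]; by rewrite h.
Qed.

Lemma kvalN (f : pser) : kval (- f) = kval f.
Proof.
case e: (kval f) => [x|]; last by move/kval_None: e => ->; rewrite oppr0; apply/kval_None.
have [q [h1 h2] ->] := kval_Some e; apply: kvalE.
by split=> [|r]; rewrite /= /kopp oppr_eq0 //; apply: h2.
Qed.

(** Only a lower bound: the coefficient at [q] may vanish, which allows for cancellation in sums. *)
Definition val_ge (f : pser) (q : rat) := forall r, f r != 0 -> q <= r.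

(** Exponents at least p and at least q add up to p + q only if both bounds are attained, so a
    single product contributes there. *)
Lemma val_geM (f g : pser) p q : val_ge f p -> val_ge g q ->
  val_ge (f * g) (p + q) /\ (f * g) (p + q) = f p * g q.
Proof.
move=> fp gq; split=> [r /kmul_neq0[s [/fp h1 /gq h2]]|]; first lra.
rewrite ps_mul (kmulE (s := [:: p])) ?big_seq1 //; first by congr (_ * g _); ring.
by move=> r /fp h1 /gq h2; rewrite inE; apply/eqP; lra.
Qed.

Lemma has_valM (f g : pser) p q : has_val f p -> has_val g q -> has_val (f * g) (p + q).
Proof.
move=> [f1 f2] [g1 g2]; have [h1 h2] := val_geM f2 g2; split=> //.
by rewrite h2 mulf_neq0.
Qed.

Lemma has_val1 : has_val (1 : pser) 0.
Proof.
split=> [|r]; rewrite /= /kone; first by rewrite eqxx oner_eq0.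
by case: (r =P 0) => [->|]; rewrite ?eqxx.
Qed.

Lemma has_valX (f : pser) p k : has_val f p -> has_val (f ^+ k) (k%:R * p).
Proof.
move=> h; elim: k => [|k IH]; first by rewrite mul0r; apply: has_val1.
by rewrite exprS -natr1 mulrDl mul1r addrC; apply: has_valM.
Qed.

Lemma has_val_prod (I : Type) (s : seq I) (F : I -> pser) (v : I -> rat) :
  (forall i, has_val (F i) (v i)) ->
  has_val (\prod_(i <- s) F i) (\sum_(i <- s) v i).
Proof.
move=> h; elim: s => [|i s IH]; rewrite ?big_nil ?big_cons; first exact: has_val1.
exact: has_valM.
Qed.

Definition mono_fun (c : CC) (q : rat) : Kt := fun r => if r == q then c else 0.
Lemma mono_puiseux c q : puiseux (mono_fun c q).
Proof.
exists `|denq q|%N, q; split=> [|r]; first by rewrite absz_gt0 denq_neq0.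
rewrite /mono_fun; case: (r =P q) => [-> _|]; last by rewrite eqxx.
split=> //; exists (numq q); rewrite pmulrn gtz0_abs ?denq_gt0 //.
by rewrite -{1}(divq_num_den q) divfK // intr_eq0 denq_neq0.
Qed.
Definition mono c q := Pser (mono_puiseux c q).

Lemma mono_ge c q : val_ge (mono c q) q.
Proof. by move=> r; rewrite /= /mono_fun; case: (r =P q) => [->|]; rewrite ?eqxx. Qed.
Lemma monoE c q : mono c q q = c.
Proof. by rewrite /= /mono_fun eqxx. Qed.
Lemma val_ge_sum (I : Type) (s : seq I) (F : I -> pser) q :
  (forall i, val_ge (F i) q) -> val_ge (\sum_(i <- s) F i) q.
Proof.
move=> h r; rewrite ps_coef_sum; apply: contraNT; rewrite -ltNge => rq.
rewrite big1 // => i _; apply/eqP; apply: contraLR rq => /h; by rewrite -leNgt.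
Qed.

(** * Pfaffians *)

(* [contract a F] sums, with alternating signs, A a c times F on the list with c
   removed; it is the row expansion in [pf_aux]. The antisymmetry of two
   contractions is what makes the Pfaffian alternating. *)
Section Contraction.
Variables (R : comNzRingType) (T : eqType) (A : T -> T -> R).

Fixpoint contract (a : T) (F : seq T -> R) (l : seq T) : R :=
  match l with
  | [::] => 0
  | c :: l' => A a c * F l' - contract a (fun s => F (c :: s)) l'
  end.

(** [contract] evaluates its functional only on the list with one entry removed. *)
Lemma eq_contract a F G l : (forall s, size s = (size l).-1 -> F s = G s) ->
  contract a F l = contract a G l.
Proof.
elim: l F G => //= c l IH F G h; rewrite h //; congr (_ - _).
by case: l IH h => // d l IH h; apply: IH => s hs; apply: h; rewrite /= hs.
Qed.

Lemma contractN a F l : contract a (fun s => - F s) l = - contract a F l.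
Proof. by elim: l F => [|c l IH] F /=; rewrite ?oppr0 // IH; ring. Qed.

Lemma contractB a u (F G : seq T -> R) l :
  contract a (fun s => u * F s - G s) l = u * contract a F l - contract a G l.
Proof. by elim: l F G => [|c l IH] F G /=; rewrite ?IH; ring. Qed.

(** Removing two entries in either order leaves the same list, but the removal of the earlier entry
    shifts the position of the later one by one, whence the sign. *)
Lemma contract_anti a b F l :
  contract a (contract b F) l = - contract b (contract a F) l.
Proof.
elim: l F => [|c l IH] F; first by rewrite /= oppr0.
by rewrite /= !contractB [contract a (contract b _) l]IH; ring.
Qed.

Definition alternating (F : seq T -> R) := forall l1 a b l2,
  F (l1 ++ a :: b :: l2) = - F (l1 ++ b :: a :: l2).

Lemma alternating_cons F c : alternating F -> alternating (fun s => F (c :: s)).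
Proof. by move=> h l1 a b l2; apply: (h (c :: l1)). Qed.

(** The two terms removing a or b are exchanged with opposite signs; the remaining terms keep both
    entries and change sign through F. *)
Lemma alternating_contract c F : alternating F -> alternating (contract c F).
Proof.
move=> hF l1 a b l2; elim: l1 F hF => [|d l1 IH] F hF /=.
  rewrite (@eq_contract _ _ (fun s => - F (b :: a :: s))); last first.
    by move=> s _; apply: (hF [::]).
  by rewrite contractN; ring.
by rewrite hF IH; [ring|apply: alternating_cons].
Qed.

(** The sign is left existential, since only valuations of Pfaffians are used later. *)
Lemma alternating_move F p s a t : alternating F ->
  exists e : bool, F (p ++ s ++ a :: t) = (-1) ^+ e * F (p ++ a :: s ++ t).
Proof.
move=> hF; elim: s p => [|b s IH] p; first by exists false; rewrite mul1r.
have [e he] := IH (rcons p b).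
exists (~~ e); move: he; rewrite -!cats1 -!catA /= => ->.
by rewrite [F (p ++ b :: _)]hF signrN; ring.
Qed.

Lemma alternating_perm F l l' : alternating F -> perm_eq l l' ->
  exists e : bool, F l' = (-1) ^+ e * F l.
Proof.
elim: l l' F => [|a l IH] l' F hF.
  by rewrite perm_sym => /perm_nilP ->; exists false; rewrite mul1r.
move=> hp; have al' : a \in l' by rewrite -(perm_mem hp) mem_head.
case/splitPr: al' hp => s t hp.
have [e1 h1] := alternating_move [::] s a t hF.
have [|e2 h2] := IH (s ++ t) _ (alternating_cons a hF).
  by rewrite -(perm_cons a) (perm_trans hp) // perm_catC /= perm_cons perm_catC.
by exists (e1 (+) e2); rewrite signr_addb h1 /= h2 mulrA.
Qed.

Lemma alternating_dup F a l : (forall x : R, x = - x -> x = 0) ->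
  alternating F -> a \in l -> F (a :: l) = 0.
Proof.
move=> h2 hF al; case/splitPr: al => s t.
have [e ->] := alternating_move [:: a] s a t hF.
by rewrite (h2 (F _)) ?mulr0 //; apply: (hF [::]).
Qed.

Fixpoint pf (fuel : nat) (l : seq T) : R :=
  match l with
  | [::] => 1
  | a :: l' => if fuel is m.+1 then contract a (pf m) l' else 0
  end.

(** A swap behind the head is handled by [alternating_contract]. A swap involving the head leaves
    the pairing of a with b, which changes sign by [anti], and a double contraction, which changes
    sign by [contract_anti]. *)
Lemma alternating_pf (anti : forall i j, A i j = - A j i) m : alternating (pf m).
Proof.
elim: m => [|m IH] l1 a b l2; first by case: l1 => [|c l1] /=; rewrite oppr0.
case: l1 => [|c l1] /=; last exact: alternating_contract.
case: m IH => [|m] IH.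
  (* With the fuel exhausted the inner Pfaffian is zero on nonempty lists, so only the pairing of a
     with b survives. *)
  have h x : contract x (fun=> 0) l2 = 0.
    by elim: l2 => //= c l ->; rewrite mulr0 subr0.
  by rewrite /= !h anti; ring.
rewrite [contract a (fun s => _) l2](_ : _ = contract a (contract b (pf m)) l2) //.
rewrite [contract b (fun s => _) l2](_ : _ = contract b (contract a (pf m)) l2) //.
by rewrite contract_anti anti; ring.
Qed.

(** Each expansion spends one unit of fuel and removes two entries, so fuel at least the length
    never runs out. *)
Lemma pf_fuel m l : (size l <= m)%N -> pf m.+1 l = pf m l.
Proof.
elim: m l => [|m IH] [|a l] //= hl; apply: eq_contract => s hs.
by apply: IH; rewrite hs; lia.
Qed.

Lemma contractE a F l : contract a F l =
  \sum_(k <- iota 0 (size l)) (-1) ^+ k * A a (nth a l k) * F (rem_at k l).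
Proof.
elim: l F => [|c l IH] F; first by rewrite big_nil.
rewrite /= big_cons IH (iotaDl 1) big_map expr0 mul1r /rem_at /= drop0 -sumrN.
by congr (_ + _); apply: eq_bigr => k _ /=; rewrite exprS; ring.
Qed.

End Contraction.

(** * Row combinations with Pfaffian coordinates *)

Section WickVectors.
Variables (n : nat) (A : 'I_n -> 'I_n -> pser).
Hypothesis anti : forall i j, A i j = - A j i.

Lemma pf_auxE m l : pf_aux (fun i j => ps_fun (A i j)) m l = ps_fun (pf A m l).
Proof.
elim: m l => [|m IH] [|a l] //=; rewrite contractE ps_sum; congr ksum.
apply: eq_map => k; rewrite IH.
rewrite -signr_odd /ksign; case: odd.
  by rewrite expr1 mulN1r mulNr.
by rewrite expr0 mul1r.
Qed.

Definition pfset (X : {set 'I_n}) := pf A #|X| (enum X).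

(** Excess fuel is harmless and reordering costs a sign. This handles the lists obtained from
    [enum X] by adding or deleting one index. *)
Lemma pfset_seq m (X : {set 'I_n}) l : uniq l -> l =i X -> (size l <= m)%N ->
  exists e : bool, pf A m l = (-1) ^+ e * pfset X.
Proof.
move=> ul lX hm.
have sl : size l = #|X| by rewrite -(card_uniqP ul); apply: eq_card.
have -> : pf A m l = pf A #|X| l.
  rewrite -sl -(subnK hm); elim: (m - size l)%N => // k IH.
  by rewrite addSn pf_fuel ?IH // leq_addl.
apply: alternating_perm; first exact: alternating_pf.
by apply: uniq_perm => //; [apply: enum_uniq|move=> i; rewrite mem_enum lX].
Qed.

Lemma kval_sign (e : bool) (f : pser) : kval ((-1) ^+ e * f) = kval f.
Proof. by case: e; rewrite ?expr1 ?mulN1r ?kvalN // expr0 mul1r. Qed.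

Definition rowA (i : 'I_n) (e : Jidx n) : pser :=
  match e with inl k => (i == k)%:R | inr k => A i k end.

Lemma rem_at_filter (T : eqType) (a : T) k (l : seq T) : uniq l -> (k < size l)%N ->
  rem_at k l = [seq i <- l | i != nth a l k].
Proof.
elim: l k => [|c l IH] [|k] //= /andP[cl ul] hk.
  rewrite /rem_at /= drop0 eqxx; apply: esym; apply/all_filterP/allP => i il.
  by apply: contraNneq cl => <-.
rewrite /rem_at /= [take _ _ ++ _]IH //; case: eqP => // e; case/negP: cl.
by rewrite e mem_nth.
Qed.

(** The row coefficients are the signed Pfaffians of X with one index deleted, and they reappear as
    the identity coordinates. Coordinate k on the side of A is, up to sign, the expansion along row
    k of the Pfaffian of k followed by X; it vanishes for k in X because k is repeated. *)
Lemma wick_row (X : {set 'I_n}) : exists c : 'I_n -> pser,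
  let y e := \sum_(i < n) c i * rowA i e in
  forall k, kval (y (inl k)) = (if k \in X then kval (pfset (X :\ k)) else None) /\
            kval (y (inr k)) = (if k \in X then None else kval (pfset (k |: X))).
Proof.
set l := enum X.
have ul : uniq l by apply: enum_uniq.
pose c (i : 'I_n) : pser := if i \in X then
  (-1) ^+ index i l * pf A #|X| (rem_at (index i l) l) else 0.
exists c => y k.
have yl : y (inl k) = c k.
  rewrite /y (bigD1 k) //= eqxx mulr1 big1 ?addr0 // => i ik.
  by rewrite (negbTE ik) mulr0.
have yr : y (inr k) = - pf A #|X|.+1 (k :: l).
  rewrite /= contractE /y -sumrN (bigID (mem X)) /= [X in _ + X]big1 ?addr0; last first.
    by move=> i iX; rewrite /c (negbTE iX) mul0r.
  rewrite -big_enum /= -/l (big_nth k) /index_iota subn0.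
  apply: eq_big_seq => j; rewrite mem_iota => /= hj.
  have jX : nth k l j \in X by rewrite -mem_enum mem_nth.
  by rewrite /c jX index_uniq // anti; ring.
rewrite yl yr kvalN; split.
  rewrite /c; case: ifP => kX; last exact/kval_None.
  have kl : k \in l by rewrite mem_enum.
  have ukl : uniq (rem_at (index k l) l).
    by rewrite (@rem_at_filter _ k) ?index_mem // filter_uniq.
  have [||e ->] := @pfset_seq #|X| (X :\ k) _ ukl.
  - by move=> i; rewrite (@rem_at_filter _ k) ?index_mem // mem_filter nth_index // mem_enum !inE.
  - by rewrite (@rem_at_filter _ k) ?index_mem // size_filter cardE count_size.
  by rewrite -signr_odd !kval_sign.
case: ifP => kX.
  apply/kval_None; apply: alternating_dup; [exact: ps_neg_eq|exact: alternating_pf|].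
  by rewrite mem_enum.
have [|||e ->] := @pfset_seq #|X|.+1 (k |: X) (k :: l); last exact: kval_sign.
- by rewrite /= ul mem_enum kX.
- by move=> i; rewrite inE mem_enum !inE.
- by rewrite /= ltnS cardE.
Qed.

End WickVectors.

(** * Rational approximation and generic points *)

(** A perturbation of size below [d] in the variable with coefficient [g k] preserves the sign of
    every nonzero [f k]. *)
Lemma tight_radius (R : realFieldType) (K : Type) (s : seq K) (f g : K -> R) :
  exists2 d, 0 < d & forall k, List.In k s -> f k != 0 -> `|g k| * d < `|f k|.
Proof.
elim: s => [|k s [d d0 hd]]; first by exists 1.
have [fk|fk] := eqVneq (f k) 0.
  by exists d => // k' /= [<-|/hd //]; rewrite fk eqxx.
have f0 : 0 < `|f k| by rewrite normr_gt0.
(* The added 1 keeps the denominator positive when [g k] vanishes. *)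
have g0 : 0 < `|g k| + 1 by rewrite ltr_wpDl.
exists (Num.min d (`|f k| / (`|g k| + 1))); first by rewrite lt_min d0 divr_gt0.
move=> k' /= [<-|hk] fk'.
  apply: (@le_lt_trans _ _ (`|g k| * (`|f k| / (`|g k| + 1)))).
    by rewrite ler_wpM2l // ge_min lexx orbT.
  rewrite mulrA ltr_pdivrMr // mulrC ltr_pM2l // ltrDl //.
apply: le_lt_trans (hd _ hk fk').
by rewrite ler_wpM2l // ge_min lexx.
Qed.

(** Induction on the number of variables, removing the last one: either a form vanishing at x
    determines it as a rational affine function of the others, or it can be moved to a nearby
    rational without changing any sign. *)
Lemma rational_solution_nat (R : realType) (K : finType) n (x : nat -> R)
    (c : K -> rat) (a : K -> nat -> rat) :
  exists y : nat -> rat, forall k,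
    let phi := ratr (c k) + \sum_(i < n) ratr (a k i) * x i in
    let psi := c k + \sum_(i < n) a k i * y i in
    (0 < phi) = (0 < psi) /\ (phi == 0) = (psi == 0).
Proof.
elim: n c a => [|n IH] c a.
  by exists (fun=> 0) => k /=; rewrite !big_ord0 !addr0 ltr0q fmorph_eq0.
pose phi k := ratr (c k) + \sum_(i < n.+1) ratr (a k i) * x i.
have extend (y : nat -> rat) v k :
    \sum_(i < n.+1) a k i * (if (i : nat) == n then v else y i) =
    \sum_(i < n) a k i * y i + a k n * v.
  rewrite big_ord_recr /= eqxx; congr (_ + _).
  by apply: eq_bigr => i _ /=; rewrite ltn_eqF.
have [[k0 [p0 a0]]|none] := pselect (exists k, phi k = 0 /\ a k n != 0).
  (* The vanishing form is solved for the last variable and substituted into all forms; the new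
     coefficients stay rational. *)
  have xn : x n = ratr (- c k0 / a k0 n) +
      \sum_(i < n) ratr (- a k0 i / a k0 n) * x i.
    have a0' : ratr (a k0 n) != 0 :> R by rewrite fmorph_eq0.
    apply: (mulfI a0'); move: p0; rewrite /phi big_ord_recr /= => p0.
    rewrite mulrDr mulr_sumr.
    under eq_bigr do rewrite rmorphM /= rmorphN fmorphV mulrA mulrCA divff // mulr1 mulNr.
    rewrite sumrN rmorphM /= rmorphN fmorphV mulrCA divff // mulr1.
    apply: (addrI (ratr (c k0) + \sum_(i < n) ratr (a k0 i) * x i)).
    by rewrite -addrA p0; ring.
  have [y hy] := IH (fun k => c k + a k n * (- c k0 / a k0 n))
                    (fun k i => a k i + a k n * (- a k0 i / a k0 n)).
  pose v := - c k0 / a k0 n + \sum_(i < n) (- a k0 i / a k0 n) * y i.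
  exists (fun i => if i == n then v else y i) => k /=.
  rewrite extend big_ord_recr /=.
  have [h1 h2] := hy k.
  have -> : ratr (c k) + (\sum_(i < n) ratr (a k i) * x i + ratr (a k n) * x n) =
    ratr (c k + a k n * (- c k0 / a k0 n)) +
     \sum_(i < n) ratr (a k i + a k n * (- a k0 i / a k0 n)) * x i.
    rewrite xn rmorphD rmorphM /= mulrDr mulr_sumr.
    rewrite [X in _ = _ + X](_ : _ = \sum_(i < n) ratr (a k i) * x i +
       \sum_(i < n) ratr (a k n) * (ratr (- a k0 i / a k0 n) * x i)); first by ring.
    by rewrite -big_split; apply: eq_bigr => i _; rewrite rmorphD rmorphM /=; ring.
  have -> : c k + (\sum_(i < n) a k i * y i + a k n * v) =
    c k + a k n * (- c k0 / a k0 n) +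
     \sum_(i < n) (a k i + a k n * (- a k0 i / a k0 n)) * y i.
    rewrite /v mulrDr mulr_sumr.
    rewrite [X in _ = _ + X](_ : _ = \sum_(i < n) a k i * y i +
       \sum_(i < n) a k n * (- a k0 i / a k0 n * y i)); first by ring.
    by rewrite -big_split; apply: eq_bigr => i _ /=; ring.
  by [].
(* Now every form vanishing at x is free of the last variable, so only the nonzero forms limit how
   far it may move. *)
have [d d0 hd] := tight_radius (enum K) phi (fun k => ratr (a k n)).
have [v] := @rat_in_itvoo R (x n - d) (x n + d) ltac:(lra).
rewrite in_itv /= => /andP[v1 v2].
have dv : `|ratr v - x n| < d by apply/ltr_normlP; split; lra.
have [y hy] := IH (fun k => c k + a k n * v) a.
exists (fun i => if i == n then v else y i) => k /=; rewrite extend.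
have [h1 h2] := hy k.
have -> : c k + (\sum_(i < n) a k i * y i + a k n * v) =
  c k + a k n * v + \sum_(i < n) a k i * y i by ring.
rewrite -h1 -h2 -/(phi k).
have -> : ratr (c k + a k n * v) + \sum_(i < n) ratr (a k i) * x i =
   phi k + ratr (a k n) * (ratr v - x n).
  by rewrite /phi big_ord_recr /= rmorphD rmorphM /=; ring.
have [p0|p0] := eqVneq (phi k) 0.
  have -> : a k n = 0 by apply/eqP; apply: contrapT => /negP h; case: none; exists k.
  by rewrite rmorph0 mul0r addr0 p0 eqxx.
have kin : List.In k (enum K).
  have : k \in enum K by rewrite mem_enum.
  elim: (enum K) => //= k' s IHs; rewrite inE => /orP[/eqP ->|/IHs]; [by left|by right].
have lt1 : `|ratr (a k n) * (ratr v - x n)| < `|phi k|.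
  rewrite normrM; apply: le_lt_trans (hd k kin p0).
  by rewrite ler_wpM2l // ltW.
move: lt1; set z := ratr (a k n) * _; move=> lt1.
have [f0|f0] := ltP 0 (phi k).
  move: lt1; rewrite (gtr0_norm f0) => /ltr_normlP[l1 l2].
  have l3 : 0 < phi k + z by lra.
  by rewrite l3 gt_eqF.
have f1 : phi k < 0 by rewrite lt_neqAle p0.
move: lt1; rewrite (ltr0_norm f1) => /ltr_normlP[l1 l2].
have l3 : phi k + z < 0 by lra.
by rewrite lt_eqF // ltNge ltW.
Qed.

Lemma rational_solution (R : realType) (K I : finType) (x : I -> R)
    (c : K -> rat) (a : K -> I -> rat) :
  exists y : I -> rat, forall k,
    let phi := ratr (c k) + \sum_i ratr (a k i) * x i in
    let psi := c k + \sum_i a k i * y i in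
    (0 < phi) = (0 < psi) /\ (phi == 0) = (psi == 0).
Proof.
(* The default 0 is never read: the sums only use indices below the cardinality of I. *)
pose ext (S : ringType) (f : I -> S) (i : nat) : S :=
  if insub i is Some o then f (@enum_val I I o) else 0.
have extE (S : ringType) (f : I -> S) (o : 'I_#|I|) : ext S f o = f (enum_val o).
  by rewrite /ext valK.
have [y hy] := rational_solution_nat #|I| (ext R x) c (fun k => ext _ (a k)).
exists (fun i => y (enum_rank i)) => k; move: (hy k) => /=.
have -> : \sum_(i < #|I|) ratr (ext _ (a k) i) * ext R x i = \sum_i ratr (a k i) * x i.
  rewrite [RHS](reindex (@enum_val I I)) /=; last exact/onW_bij/enum_val_bij.
  by apply: eq_bigr => i _; rewrite !extE.
have -> // : \sum_(i < #|I|) ext _ (a k) i * y i = \sum_i a k i * y (enum_rank i).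
rewrite [RHS](reindex (@enum_val I I)) /=; last exact/onW_bij/enum_val_bij.
by apply: eq_bigr => i _; rewrite !extE enum_valK.
Qed.

(** The point is sought on the curve of powers of s, where each form becomes a nonzero polynomial in
    s; a non-root of their product exists because the field is infinite. *)
Lemma generic_point (F : numFieldType) (I K : finType) (P : pred K) (a : K -> I -> F) :
  (forall k, P k -> exists i, a k i != 0) ->
  exists g : I -> F, (forall i, g i != 0) /\
    forall k, P k -> \sum_i g i * a k i != 0.
Proof.
move=> ha.
pose q k : {poly F} := \sum_i a k i *: 'X^(enum_rank i).
have q0 k : P k -> q k != 0.
  move=> /ha[i ai]; apply: contraNneq ai => /(congr1 (fun p : {poly F} => p`_(enum_rank i))).
  rewrite coef0 coef_sum (bigD1 i) //= coefZ coefXn eqxx mulr1 big1 ?addr0 => [->//|j ji].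
  by rewrite coefZ coefXn (inj_eq val_inj) (inj_eq enum_rank_inj) eq_sym (negbTE ji) mulr0.
(* The factor ['X] forces s, and hence every coordinate, to be nonzero. *)
pose Q := 'X * \prod_(k | P k) q k.
have Q0 : Q != 0.
  by rewrite mulf_neq0 ?polyX_eq0 //; apply/prodf_neq0.
have [s hs] : exists s : F, ~~ root Q s.
  apply: contrapT => h.
  have al : all (root Q) [seq i%:R | i <- iota 0 (size Q)].
    by apply/allP => z _; apply/negPn/negP => hz; apply: h; exists z.
  have := max_poly_roots Q0 al; rewrite size_map size_iota ltnn.
  rewrite map_inj_uniq ?iota_uniq => [/(_ isT)//|u v /eqP].
  by rewrite eqr_nat => /eqP.
move: hs; rewrite rootE hornerM hornerX mulf_eq0 negb_or horner_prod => /andP[s0 hs].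
exists (fun i => s ^+ enum_rank i); split=> [i|k Pk]; first by rewrite expf_neq0.
move/prodf_neq0: hs => /(_ k Pk).
rewrite /q horner_sum; apply: contraNneq => e; apply/eqP; rewrite -[RHS]e.
by apply: eq_bigr => i _; rewrite hornerZ hornerXn mulrC.
Qed.

(** * Circuits of the Wick vector *)

Lemma symdiffE (T : finType) (X Y : {set T}) i :
  (i \in symdiff X Y) = (i \in X) (+) (i \in Y).
Proof. by rewrite !inE; case: (i \in X); case: (i \in Y). Qed.

Lemma symdiff1 (T : finType) (X : {set T}) k : symdiff X [set k] = if k \in X then X :\ k else k |: X.
Proof.
apply/setP => i; rewrite symdiffE finset.in_set1.
case: ifP => kX; rewrite (finset.in_setD1, finset.in_setU1);
by have [->|_] := eqVneq i k; rewrite ?kX //= addbF.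
Qed.

Section Flips.
Variable n : nat.
Implicit Types T J : {set 'I_n}.

Lemma starK : involutive (@star n). Proof. by case. Qed.

Definition idx (e : Jidx n) : 'I_n := match e with inl i => i | inr i => i end.
(** On the level of [barset] this exchanges [e] and [star e]. *)
Definition flip (T : {set 'I_n}) (e : Jidx n) := symdiff T [set idx e].

Lemma idx_star e : idx (@star n e) = idx e. Proof. by case: e. Qed.

Lemma flip_flip (T : {set 'I_n}) e : flip (flip T e) e = T.
Proof. by apply/setP => i; rewrite !symdiffE -addbA addbb addbF. Qed.

Lemma flipC (T : {set 'I_n}) (e f : Jidx n) : flip (flip T e) f = flip (flip T f) e.
Proof. by apply/setP => i; rewrite !symdiffE addbAC. Qed.

Lemma flip_star (T : {set 'I_n}) e : flip T (star e) = flip T e.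
Proof. by rewrite /flip idx_star. Qed.

Lemma flip_compl T J e : symdiff (~: flip T e) J = symdiff (symdiff (~: T) J) [set idx e].
Proof.
apply/setP => i; rewrite !symdiffE !finset.in_setC !symdiffE.
by case: (i \in T); case: (i \in J); case: (i \in _).
Qed.

Lemma in_barset (T : {set 'I_n}) e :
  (e \in barset T) = match e with inl i => i \in T | inr i => i \notin T end.
Proof. by rewrite finset.in_set. Qed.

Lemma in_barset_star (T : {set 'I_n}) e : (star e \in barset T) = (e \notin barset T).
Proof. by rewrite !in_barset; case: e => i //=; rewrite negbK. Qed.

Lemma in_barset_flip (T : {set 'I_n}) e f :
  (e \in barset (flip T f)) = (e \in barset T) (+) (idx e == idx f).
Proof.
rewrite !in_barset; case: e => i; rewrite symdiffE finset.in_set1 //=.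
by rewrite addNb.
Qed.

(** A [barset] contains exactly one element of each pair exchanged by [star]. *)
Lemma idx_inj_barset (T : {set 'I_n}) e f :
  e \in barset T -> f \in barset T -> (idx e == idx f) = (e == f).
Proof.
move=> eT fT; apply/eqP/eqP => [|->//]; move: eT fT.
rewrite !in_barset; case: e f => i [] j /= hi hj ij; rewrite ij // in hi *.
  by rewrite hi in hj.
by rewrite hj in hi.
Qed.

Lemma circ_vec_flip (p : {set 'I_n} -> trop) T e :
  circ_vec p T e = if e \in barset T then p (flip T e) else None.
Proof.
rewrite /circ_vec; case: ifP => // _; rewrite /pbar; congr p; apply/setP => i.
rewrite inE !symdiffE !inE; congr (_ (+) _).
by case: e => k; rewrite ?[_ == inr _]eqE /= ?orbF //= .
Qed.

Lemma sum_flip (S : zmodType) (h : Jidx n -> S) (T : {set 'I_n}) e : e \in barset T ->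
  \sum_(f in barset (flip T e)) h f = \sum_(f in barset T) h f - h e + h (star e).
Proof.
move=> eT; rewrite [in RHS](bigD1 e eT) /= [h e + _]addrC addrK.
rewrite (bigD1 (star e)) /=; last first.
  by rewrite in_barset_flip idx_star eqxx in_barset_star eT.
rewrite addrC; congr (_ + _); apply: eq_bigl => f.
rewrite -[RHS]/((f \in barset T) && (f != e)) in_barset_flip.
have [/eqP|fe] := eqVneq (idx f) (idx e).
  have [-> _|nfe] := eqVneq f e; first by rewrite eT ?eqxx ?andbF.
  have [-> _|] := eqVneq f (star e); first by rewrite in_barset_star eT.
  by case: f e nfe {eT} => i [] j /= ij1 ij2 /eqP ij; move: ij1 ij2; rewrite ij eqxx.
rewrite addbF; congr (_ && _).
by rewrite !(contra_neq _ fe) // => ->; rewrite ?idx_star.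
Qed.

Lemma sum_flip2 (h : Jidx n -> R) (T : {set 'I_n}) b e :
  b \in barset T -> e \in barset T -> e != b ->
  \sum_(f in barset (flip (flip T b) e)) h f =
  \sum_(f in barset T) h f - h b + h (star b) - h e + h (star e).
Proof.
move=> bT eT eb; rewrite sum_flip ?sum_flip //.
by rewrite in_barset_flip eT (idx_inj_barset eT bT) (negbTE eb).
Qed.

End Flips.

(** * Vectors of the subspace that realize the circuits *)

Section Wick.
Variables (n : nat) (U : vecK n -> Prop) (J : {set 'I_n}) (A : 'I_n -> 'I_n -> pser).
Hypothesis anti : forall i j, A i j = - A j i.
Hypothesis rep : forall x, U x <-> exists c : 'I_n -> Kt, (forall i, puiseux (c i)) /\
  (fun e => x (swapJ J e)) = lincomb c (rowIA (fun i j => ps_fun (A i j))).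

Definition toK (y : Jidx n -> pser) : vecK n := fun e => ps_fun (y e).

Lemma swapJK : involutive (swapJ J : Jidx n -> Jidx n).
Proof. by case=> i /=; case: ifP => h /=; rewrite h. Qed.

Lemma repP x : U x <-> exists c : 'I_n -> pser,
  x = toK (fun e => \sum_i c i * rowA A i (swapJ J e)).
Proof.
have lc (c : 'I_n -> pser) : lincomb (fun i => ps_fun (c i)) (rowIA (fun i j => ps_fun (A i j))) =
    toK (fun e => \sum_i c i * rowA A i e).
  apply/funext => e; rewrite /toK -big_enum ps_sum /lincomb; congr ksum.
  by apply: eq_map => i; rewrite ps_mul; case: e => k //=; case: eqP.
rewrite rep; split=> [[c [pc hx]]|[c ->]].
  exists (fun i => Pser (pc i)); apply/funext => e; rewrite -[e in LHS]swapJK.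
  by move: (lc (fun i => Pser (pc i))) => /= /(etrans hx)/(congr1 (fun f => f (swapJ J e))).
exists (fun i => ps_fun (c i)); split=> [i|]; first exact: ps_prop.
by rewrite lc; apply/funext => e; rewrite /toK swapJK.
Qed.

Lemma U_toK x : U x -> exists y, x = toK y.
Proof. by move=> /repP[c ->]; eexists. Qed.

Lemma U_lin (I : finType) (g : I -> pser) (v : I -> Jidx n -> pser) :
  (forall i, U (toK (v i))) -> U (toK (fun e => \sum_i g i * v i e)).
Proof.
move=> h.
have [c hc] : exists c : I -> 'I_n -> pser, forall i e,
    v i e = \sum_k c i k * rowA A k (swapJ J e).
  suff /choice[c hc] : forall i, exists d : 'I_n -> pser, forall e,
      v i e = \sum_k d k * rowA A k (swapJ J e) by exists c.
  move=> i; have /repP[d hd] := h i; exists d => e; apply: ps_inj.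
  by move: hd => /(congr1 (fun f => f e)).
apply/repP; exists (fun k => \sum_i g i * c i k); apply/funext => e.
congr ps_fun; under eq_bigr do rewrite hc mulr_sumr.
rewrite exchange_big; apply: eq_bigr => k _ /=; rewrite mulr_suml.
by apply: eq_bigr => i _; rewrite mulrA.
Qed.

(** Written as one sum over all indices, isotropy turns each vector y of U into a linear form
    vanishing on U. *)
Lemma U_isotropic y z : totally_isotropic U -> U (toK y) -> U (toK z) ->
  \sum_e y (star e) * z e = 0.
Proof.
move=> iso Uy Uz; apply: ps_inj; rewrite ps_zero -(iso _ _ Uy Uz).
transitivity (ps_fun (\sum_(i < n) (y (inl i) * z (inr i) + y (inr i) * z (inl i)))).
  by congr ps_fun; rewrite big_split big_sumType; apply: addrC.
by rewrite -big_enum ps_sum.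
Qed.

Let p := wickval (fun i j => ps_fun (A i j)) J.

Lemma wickvalE T : p T = let X := symdiff (~: T) J in
  if odd #|X| then None else kval (pfset A X).
Proof. by rewrite /p /wickval /pfaff pf_auxE. Qed.

(** At the complement of J the Pfaffian is that of the empty matrix. This gives a starting point for
    minimizing over the finite coordinates of p. *)
Lemma p_basis : p (~: J) != None.
Proof.
rewrite wickvalE /= (_ : symdiff _ J = finset.set0); last first.
  by apply/setP => i; rewrite symdiffE finset.setCK addbb inE.
rewrite cards0 /=; have -> : pfset A finset.set0 = 1.
  by rewrite /pfset enum_set0 cards0.
by rewrite (kvalE has_val1).
Qed.

Lemma p_rational T : p T != None -> exists q, p T = Some (ratr q).
Proof.
rewrite wickvalE /=; case: ifP => // _.
by case e: (kval _) => [x|] // _; have [q _ ->] := kval_Some e; exists q.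
Qed.

(** Flipping e in T adds or deletes one index of [X], so the Pfaffians of [wick_row] are those
    occurring in the circuit; the swap by J and [star] match up the two halves of the
    coordinates. *)
Lemma circuit_vector T : exists V, U (toK V) /\
  forall e, kval (V (star e)) = circ_vec p T e.
Proof.
set X := symdiff (~: T) J.
have XE i : (i \in X) = ~~ (i \in T) (+) (i \in J) by rewrite symdiffE finset.in_setC.
have pE e : p (flip T e) = if odd #|X| then kval (pfset A (symdiff X [set idx e])) else None.
  rewrite wickvalE /= flip_compl -/X symdiff1; have [kX|kX] := boolP (idx e \in X).
    by rewrite (cardsD1 (idx e) X) kX /=; case: odd.
  by rewrite cardsU1 kX /=; case: odd.
(* For even size of [X] all neighbours have odd index sets, the circuit vector is infinite
   everywhere, and the zero vector serves. *)
have [oX|oX] := boolP (odd #|X|); last first.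
  exists (fun=> 0); split.
    by apply/repP; exists (fun=> 0); apply/funext => e; rewrite /toK big1 // => i; rewrite mul0r.
  move=> e; rewrite circ_vec_flip pE (negbTE oX) if_same; exact/kval_None.
have [c hc] := wick_row anti X.
exists (fun e => \sum_i c i * rowA A i (swapJ J e)); split; first by apply/repP; exists c.
move=> e; rewrite circ_vec_flip pE oX symdiff1.
have {hc}hc := hc (idx e); case: hc; move: (XE (idx e)).
by case: e => k /=; rewrite in_barset; case: (k \in T); case: (k \in J) => /= -> ? ?.
Qed.
End Wick.

(** * Tropical minima *)

Section MinTwice.
Implicit Types (s : seq trop).

Lemma tle_refl t : tle t t. Proof. by case: t => //= a; rewrite lexx. Qed.

Lemma tle_trans (t u v : trop) : tle t u -> tle u v -> tle t v.
Proof. case: t u v => [a|] [b|] [c|] //=; exact: le_trans. Qed.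

Lemma tle_total (t u : trop) : tle t u || tle u t.
Proof. case: t u => [a|] [b|] //=; exact: le_total. Qed.

(** Positions in the list become distinct indices; the finite entry excludes the case of an infinite
    minimum. *)
Lemma min_twice_map (I : eqType) (s : seq I) (f : I -> trop) : uniq s ->
  min_twice [seq f i | i <- s] -> (exists2 i, i \in s & f i != None) ->
  exists i j, [/\ i \in s, j \in s, i != j, f i = f j & forall k, k \in s -> tle (f i) (f k)].
Proof.
move=> us [h [i is0 /eqP]|]; first by rewrite (h (f i)) // map_f.
move=> [i [j [+ [+ [ij [e [_ m]]]]]]]; rewrite size_map.
case: s us e m => // i0 s; set l := i0 :: s => us e m hi hj _.
move: e m; rewrite !(nth_map i0) // => e m.
exists (nth i0 l i), (nth i0 l j); split; rewrite ?mem_nth //.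
  by rewrite nth_uniq //; apply/eqP.
by move=> k kl; apply: m; apply: map_f.
Qed.

Lemma min_twice_unique (I : eqType) (s : seq I) (f : I -> trop) : uniq s ->
  ~ min_twice [seq f i | i <- s] ->
  exists i v, [/\ i \in s, f i = Some v &
    forall k w, k \in s -> k != i -> f k = Some w -> v < w].
Proof.
move=> us h.
have [i is0 m] : exists2 i, i \in s & forall k, k \in s -> tle (f i) (f k).
  have : s != [::] by apply: contra_notN h => /eqP ->; left.
  elim: s {us h} => // i s IH _; case: s IH => [|j s] IH.
    by exists i; rewrite ?mem_head // => k; rewrite inE => /eqP ->; apply: tle_refl.
  have [//|k ks mk] := IH; case: (orP (tle_total (f i) (f k))) => hik.
    exists i; first exact: mem_head.
    move=> l; rewrite inE => /orP[/eqP ->|/mk]; [exact: tle_refl|exact: tle_trans].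
  exists k; first by rewrite inE ks orbT.
  by move=> l; rewrite inE => /orP[/eqP ->|/mk].
case fi: (f i) => [v|]; last first.
  case: h; left => t /mapP[k ks ->]; have := m k ks; rewrite fi; by case: (f k).
exists i, v; split=> // k w ks ki fk.
have := m k ks; rewrite fi fk /= le_eqVlt => /orP[/eqP vw|//].
case: h; right; exists (index i s), (index k s).
rewrite size_map !index_mem; split=> //; split=> //; split.
  by move=> e; case/eqP: ki; rewrite -(nth_index i is0) e nth_index.
rewrite !(nth_map i) ?index_mem // !nth_index // fi fk vw; split=> //; split=> //.
by move=> t /mapP[l ls ->]; have := m l ls; rewrite fi vw.
Qed.

Lemma min_twice_shift s (a : R) : min_twice s -> min_twice [seq tadd t (Some a) | t <- s].
Proof.
move=> [h|[i [j [hi [hj [ij [e [e0 m]]]]]]]].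
  by left=> t /mapP[u us ->]; rewrite (h u us).
right; exists i, j; rewrite size_map !(nth_map None) // -e; do !split=> //.
  by case: (nth _ _ _) e0.
move=> t /mapP[u us ->]; have := m u us.
by case: (nth _ _ _) => [b|]; case: u us => //= c _; rewrite lerD2r.
Qed.

Lemma taddC : commutative tadd.
Proof. by case=> [a|] [b|] //=; rewrite addrC. Qed.

Lemma taddA : associative tadd.
Proof. by case=> [a|] [b|] [c|] //=; rewrite addrA. Qed.

Lemma tadd0 x : tadd x (Some 0) = x.
Proof. by case: x => //= a; rewrite addr0. Qed.

Lemma tsum_delta (I : eqType) (x : I -> trop) i (s : seq I) : uniq s ->
  tsum [seq tnsmul (j == i) (x j) | j <- s] = if i \in s then x i else Some 0.
Proof.
elim: s => //= j s IH /andP[js us]; rewrite IH // inE (eq_sym i j).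
have [<-|_] := eqVneq j i; rewrite /=.
  rewrite (negbTE js) tadd0 /tnsmul /=.
  by case: (x j) => // a; rewrite mul1r.
by case: (if _ then _ else _) => //= a; rewrite add0r.
Qed.

Lemma tsum_finite (I : eqType) (x : I -> trop) (a : I -> nat) (s : seq I) :
  (forall j, j \in s -> a j != 0%N -> x j != None) ->
  tsum [seq tnsmul (a j) (x j) | j <- s] =
  Some (\sum_(j <- s) (a j)%:R * odflt 0 (x j)).
Proof.
elim: s => [|j s IH] h; first by rewrite big_nil.
rewrite /= IH => [|k ks]; last by apply: h; rewrite inE ks orbT.
rewrite big_cons /tnsmul; have := h j (mem_head _ _); case: eqP => [->|_].
  by rewrite mul0r.
by case: (x j) => // /(_ isT).
Qed.

Lemma tsum_infinite (I : eqType) (x : I -> trop) (a : I -> nat) (s : seq I) j :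
  j \in s -> a j != 0%N -> x j = None ->
  tsum [seq tnsmul (a j) (x j) | j <- s] = None.
Proof.
move=> + aj xj; elim: s => //= k s IH; rewrite inE => /orP[/eqP <-|/IH ->].
  by rewrite /tnsmul (negbTE aj) xj.
by rewrite taddC.
Qed.
End MinTwice.

(** * Cocycles *)

Definition lift_poly n (Q : seq (pser * {ffun Jidx n -> nat})) : polyK n :=
  [seq (ps_fun t.1, t.2) | t <- Q].

Lemma lift_polyP n (P : polyK n) : coefs_puiseux P -> exists Q, P = lift_poly Q.
Proof.
elim: P => [|[f a] P IH] /=; first by exists [::].
by move=> [/= pf /IH[Q ->]]; exists ((Pser pf, a) :: Q).
Qed.

Lemma coefs_lift_poly n Q : coefs_puiseux (@lift_poly n Q).
Proof. by elim: Q => //= t Q IH; split=> //; apply: ps_prop. Qed.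

Lemma evalK_lift n Q (y : Jidx n -> pser) :
  evalK (lift_poly Q) (toK y) = ps_fun (\sum_(t <- Q) t.1 * \prod_j y j ^+ t.2 j).
Proof.
rewrite ps_sum /evalK -map_comp; congr ksum; apply: eq_map => t.
rewrite ps_mul -big_enum ps_prod /=; congr (kmul _ (kprod _)).
by apply: eq_map => j; rewrite ps_exp.
Qed.

Section Cocycles.
Variables (n : nat) (U : vecK n -> Prop) (J : {set 'I_n}) (A : 'I_n -> 'I_n -> pser).
Hypothesis anti : forall i j, A i j = - A j i.
Hypothesis rep : forall x, U x <-> exists c : 'I_n -> Kt, (forall i, puiseux (c i)) /\
  (fun e => x (swapJ J e)) = lincomb c (rowIA (fun i j => ps_fun (A i j))).
Let p := wickval (fun i j => ps_fun (A i j)) J.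

(** Membership is tested on the linear polynomial with coefficients [V (star e)], which vanishes on
    U by isotropy and whose terms at x are those of the orthogonality condition, up to the shift by
    [lam]. *)
Lemma tropicalization_orth (x : Jidx n -> trop) c : totally_isotropic U ->
  tropicalization U x -> is_circuit p c -> trop_orth x c.
Proof.
move=> iso tx [T [lam [_ ->]]].
have [V [UV valV]] := circuit_vector anti rep T.
pose Q := [seq (V (star e), [ffun j => nat_of_bool (j == e)]) | e <- enum (Jidx n)].
have := tx (lift_poly Q) _ _; rewrite /trop_orth.
have -> : trop_terms (lift_poly Q) x =
    [seq tadd (circ_vec p T e) (x e) | e <- enum (Jidx n)].
  rewrite /trop_terms -!map_comp; apply: eq_map => e.
  transitivity (tadd (kval (V (star e))) (tsum [seq
    tnsmul ([ffun k => nat_of_bool (k == e)] j) (x j) | j <- enum (Jidx n)])) => //.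
  rewrite valV.
  rewrite (eq_map (g := fun j => tnsmul (j == e) (x j))) => [|j]; last by rewrite ffunE.
  by rewrite (@tsum_delta _ x e (enum (Jidx n)) (enum_uniq _)) mem_enum.
have -> : [seq tadd (x e) (tadd (circ_vec p T e) (Some lam)) | e <- enum (Jidx n)] =
    [seq tadd t (Some lam) | t <-
      [seq tadd (circ_vec p T e) (x e) | e <- enum (Jidx n)]].
  by rewrite -map_comp; apply: eq_map => e /=; rewrite taddA [tadd (x e) _]taddC.
move=> h; apply: min_twice_shift; apply: h.
  split; last exact: coefs_lift_poly.
  rewrite -!map_comp map_inj_uniq => [|e e' /= /ffunP/(_ e)]; first by rewrite -enumT enum_uniq.
  by rewrite !ffunE eqxx; case: eqP.
move=> y Uy; have [z yz] := U_toK rep Uy; rewrite yz evalK_lift -ps_zero.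
congr ps_fun; rewrite big_map big_enum /=.
rewrite -[RHS](U_isotropic iso UV (z := z)); last by rewrite -yz.
apply: eq_bigr => e _; congr (_ * _); rewrite (bigD1 e) //= ffunE eqxx expr1.
by rewrite big1 ?mulr1 // => j je; rewrite ffunE (negbTE je).
Qed.

(** Here [y] is a rational stand-in for x on its support. The last three hypotheses make the
    combination of the circuit vectors of the sets [flip T b] vanish off the support, have valuation
    at least [y], and attain it for generic parameters. *)
Lemma lift_cocycle (x : Jidx n -> trop) (y : Jidx n -> rat) T (q : {set 'I_n} -> rat) :
  admissible x -> p T != None -> (forall S, p S != None -> p S = Some (ratr (q S))) ->
  (forall b e, b \in barset T -> e \in barset T -> e != b -> x b != None ->
     x (star e) = None -> p (flip (flip T b) e) = None) ->
  (forall b j, b \in barset T -> j \notin barset T -> x b != None -> x j != None ->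
     p (flip (flip T b) j) != None -> q T + y j <= q (flip (flip T b) j) + y b) ->
  (forall j, j \notin barset T -> x j != None -> exists b,
     [/\ b \in barset T, x b != None, p (flip (flip T b) j) != None &
         q T + y j = q (flip (flip T b) j) + y b]) ->
  exists u : Jidx n -> pser, U (toK u) /\
    forall e, if x e is None then u e = 0 else has_val (u e) (y e).
Proof.
move=> adm pT qE hnone hle heq.
have /choice[V hV] : forall b, exists W : Jidx n -> pser, U (toK W) /\
    forall e, kval (W (star e)) = circ_vec p (flip T b) e.
  by move=> b; apply: circuit_vector anti rep (flip T b).
have valV b e : kval (V b e) =
    if star e \in barset (flip T b) then p (flip (flip T b) e) else None.
  by rewrite -{1}[e]starK (hV b).2 circ_vec_flip flip_star.
have hv S f : p S != None -> kval f = p S -> has_val f (q S).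
  move=> pS; rewrite (qE _ pS) => /kval_Some[r hr e].
  by have -> : q S = r by apply: (fmorph_inj (ratr : rat -> R)).
pose B b := (b \in barset T) && (x b != None).
(* The coefficient that the summand b contributes, up to the factor [g b], to the exponent [y j] of
   coordinate j of [u]. *)
pose alpha (j b : Jidx n) : CC := if B b then V b j (y j - y b + q T) else 0.
have [|g [g0 hg]] := @generic_point CC (Jidx n) (Jidx n)
    [pred j | (j \notin barset T) && (x j != None)] alpha.
  move=> j /= /andP[jT xj]; have [b [bT xb pb eb]] := heq j jT xj.
  exists b; rewrite /alpha /B bT xb /=.
  (* Otherwise b would be [star j], and both would lie in the support, against admissibility. *)
  have jb : idx j != idx b.
    apply: contraTneq (erefl true) => ij; apply/negP => _.
    have bj : star j = b.
      apply/eqP; rewrite -(@idx_inj_barset n T) // ?in_barset_star ?jT //.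
      by rewrite idx_star ij.
    by case: (adm j); split; apply/eqP => //; rewrite bj.
  have [|h _] := hv _ (V b j) pb.
    by rewrite valV in_barset_flip in_barset_star jT idx_star (negbTE jb).
  by have -> : y j - y b + q T = q (flip (flip T b) j) by lra.
pose u e := \sum_b (if B b then mono (g b) (y b - q T) else 0) * V b e.
exists u; split; first by apply: U_lin => // b; case: (hV b).
move=> e; case xe: (x e) => [v|]; last first.
  apply: big1 => b _; case: ifP => [/andP[bT xb]|]; last by rewrite mul0r.
  suff /kval_None -> : kval (V b e) = None by rewrite mulr0.
  rewrite valV in_barset_flip in_barset_star idx_star.
  have [eT|eT] /= := boolP (e \in barset T).
    by rewrite (idx_inj_barset eT bT); case: eqP => // eb; rewrite -eb xe in xb.
  have [//|eb] := eqVneq (idx e) (idx b).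
  rewrite -flip_star; apply: hnone => //; rewrite ?in_barset_star ?starK //.
  by apply: contraNneq eb => <-; rewrite idx_star.
have xe0 : x e != None by rewrite xe.
have xse : x (star e) = None.
  by apply/eqP; apply: contrapT => /negP h; case: (adm e); split; apply/eqP.
(* Inside [barset T] only the summand b = e is nonzero; outside, several summands may meet at the
   leading exponent and genericity is used. *)
have [eT|eT] := boolP (e \in barset T).
  have -> : u e = mono (g e) (y e - q T) * V e e.
    rewrite /u (bigD1 e) // big1 => [|b be].
      by rewrite /B eT xe0; apply: addr0.
    case: ifP => [/andP[bT xb]|]; last by rewrite mul0r.
    suff /kval_None -> : kval (V b e) = None by rewrite mulr0.
    rewrite valV in_barset_flip in_barset_star eT idx_star (idx_inj_barset eT bT).
    by rewrite eq_sym (negbTE be).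
  rewrite -[X in has_val _ X](subrK (q T)); apply: has_valM.
    by split; [rewrite monoE g0|apply: mono_ge].
  by apply: hv => //; rewrite valV in_barset_flip in_barset_star eT idx_star eqxx flip_flip.
have vb b : B b -> val_ge (V b e) (y e - y b + q T).
  move=> /andP[bT xb] r hr.
  have Vb : V b e != 0 by apply: contraNneq hr => ->.
  have : kval (V b e) != None by apply: contraNneq Vb => /kval_None ->.
  rewrite valV; case: ifP => // hin pb.
  have [|_ /(_ r hr)] := hv _ (V b e) pb; first by rewrite valV hin.
  have := hle b e bT eT xb xe0 pb; lra.
have term b : val_ge ((if B b then mono (g b) (y b - q T) else 0) * V b e) (y e) /\
   ((if B b then mono (g b) (y b - q T) else 0) * V b e) (y e) = g b * alpha e b.
  rewrite /alpha; case: ifP => hB; last first.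
    by rewrite mul0r mulr0; split=> // r; rewrite eqxx.
  have [h1 h2] := val_geM (@mono_ge (g b) (y b - q T)) (vb b hB).
  move: h1 h2; rewrite (_ : y b - q T + (y e - y b + q T) = y e); last by ring.
  by rewrite monoE.
split.
  rewrite /u ps_coef_sum; under eq_bigr do rewrite (term _).2.
  by apply: hg; rewrite /= eT xe0.
by apply: val_ge_sum => b; case: (term b).
Qed.
End Cocycles.

Lemma sum_pred1 (S : comNzRingType) (I : finType) (b : I) (f : I -> S) :
  \sum_e (e == b)%:R * f e = f b.
Proof.
rewrite (bigD1 b) //= eqxx mul1r big1 ?addr0 // => e eb.
by rewrite (negbTE eb) mul0r.
Qed.

(** * Terms of a polynomial at a point and at its lift *)

Section Terms.
Variables (n : nat) (x : Jidx n -> trop).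
Implicit Types t : pser * {ffun Jidx n -> nat}.

Definition finite_term t :=
  (t.1 != 0) && [forall j, (t.2 j != 0%N) ==> (x j != None)].

Definition trop_term t :=
  tadd (kval t.1) (tsum [seq tnsmul (t.2 j) (x j) | j <- enum (Jidx n)]).

Lemma trop_termE t q : (t.1 != 0 -> has_val t.1 q) -> trop_term t =
  if finite_term t then Some (ratr q + \sum_j (t.2 j)%:R * odflt 0 (x j)) else None.
Proof.
rewrite /trop_term /finite_term => hq.
have [t0|t0] := eqVneq t.1 0; first by rewrite /= t0 (kval_None 0).2.
rewrite (kvalE (hq t0)) /=; case: forallP => [h|].
  rewrite tsum_finite ?big_enum // => j _ tj.
  by move: (h j); rewrite tj.
move/existsNP => [j /negP]; rewrite negb_imply negbK => /andP[tj /eqP xj].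
by rewrite (@tsum_infinite _ x t.2 (enum (Jidx n)) j) // mem_enum.
Qed.

(** The terms that are infinite at x are exactly those that vanish at the lift [u]; the others have
    the valuation predicted by [y]. *)
Lemma term_val (u : Jidx n -> pser) (y : Jidx n -> rat) t q :
  (forall e, if x e is None then u e = 0 else has_val (u e) (y e)) ->
  (t.1 != 0 -> has_val t.1 q) ->
  if finite_term t then
    has_val (t.1 * \prod_j u j ^+ t.2 j) (q + \sum_j (t.2 j)%:R * y j)
  else t.1 * \prod_j u j ^+ t.2 j = 0.
Proof.
move=> hu hq; rewrite /finite_term.
have [t0|t0] := eqVneq t.1 0; first by rewrite /= t0 mul0r.
case: forallP => [h|] /=.
  apply: has_valM; first exact: hq.
  apply: has_val_prod => j; have [->|tj] := eqVneq (t.2 j) 0%N.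
    by rewrite mul0r; apply: has_val1.
  apply: has_valX; move: (h j) (hu j); rewrite tj /=; by case: (x j).
move/existsNP => [j /negP]; rewrite negb_imply negbK => /andP[tj /eqP xj].
rewrite (bigD1 j) //=; move: (hu j); rewrite xj => ->.
by rewrite expr0n (negbTE tj) mul0r mulr0.
Qed.
End Terms.

(** * Cocycles lie in the tropicalization *)

Section CocycleTropical.
Variables (n : nat) (U : vecK n -> Prop) (J : {set 'I_n}) (A : 'I_n -> 'I_n -> pser).
Hypothesis anti : forall i j, A i j = - A j i.
Hypothesis rep : forall x, U x <-> exists c : 'I_n -> Kt, (forall i, puiseux (c i)) /\
  (fun e => x (swapJ J e)) = lincomb c (rowIA (fun i j => ps_fun (A i j))).
Let p := wickval (fun i j => ps_fun (A i j)) J.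

(** Lexicographic minimization, first of [m], then of [w] among the minimizers. The count [m] is
    real-valued so that [sum_flip2] applies to both. *)
Lemma optimal_basis (x : Jidx n -> trop) (q : {set 'I_n} -> rat) :
  let m T : R := \sum_(e in barset T) (x e != None)%:R in
  let w T : R := ratr (q T) - \sum_(e in barset T) odflt 0 (x e) in
  exists T, [/\ p T != None, forall S, p S != None -> m T <= m S &
    forall S, p S != None -> m S = m T -> w T <= w S].
Proof.
move=> m w.
have [T1 p1 h1] := @arg_minP _ _ _ (~: J) (fun S => p S != None) m (p_basis J A).
have [|T /andP[pT /eqP mT] h2] := @arg_minP _ _ _ T1
  (fun S => (p S != None) && (m S == m T1)) w _; first by rewrite p1 eqxx.
exists T; split=> // [S pS|S pS mS]; first by rewrite mT h1.
by apply: h2; rewrite pS mS mT eqxx.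
Qed.

Lemma cocycle_tropicalization x : cocycle_space p x -> tropicalization U x.
Proof.
move=> [adm orth] P [uP pP] vanish; have [Q PQ] := lift_polyP pP.
have uQ : uniq Q.
  by move: uP; rewrite PQ -map_comp; apply: map_uniq.
have -> : trop_terms P x = [seq trop_term x t | t <- Q].
  by rewrite PQ /trop_terms -map_comp.
apply: contrapT => /(min_twice_unique uQ)[m [v [mQ mv mmin]]].
have /choice[vq hvq] : forall f : pser, exists r, f != 0 -> has_val f r.
  move=> f; have [->|f0] := eqVneq f 0; first by exists 0.
  by have [r hr] := has_val_ex f0; exists r.
have /choice[q qE] : forall S, exists r, p S != None -> p S = Some (ratr r).
  move=> S; have [->|pS] := eqVneq (p S) None; first by exists 0.
  by have [r hr] := p_rational pS; exists r.
pose xr e := odflt 0 (x e).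
have [T [pT hm hw]] := optimal_basis x q.
have xstar e : x e != None -> x (star e) = None.
  by move=> xe; apply/eqP; apply: contrapT => /negP h; case: (adm e); split; apply/eqP.
(* The double flip trades b, in the support, for an element outside it, and gains nothing at e: [m]
   would drop. *)
have hnone b e : b \in barset T -> e \in barset T -> e != b -> x b != None ->
    x (star e) = None -> p (flip (flip T b) e) = None.
  move=> bT eT eb xb xe; apply/eqP; apply: contrapT => /negP /hm.
  rewrite sum_flip2 // xb (xstar b xb) xe eqxx.
  by case: (x e != None) => /=; lra.
have bstar b j : x b != None -> x j != None -> star j != b.
  by move=> xb xj; apply: contraNneq xb => <-; rewrite xstar.
(* Flipping b and [star j] trades b for j, so [m] is unchanged and the minimality of [w] applies. *)
have hle b j : b \in barset T -> j \notin barset T -> x b != None -> x j != None ->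
    p (flip (flip T b) j) != None ->
    ratr (q T) + xr j <= ratr (q (flip (flip T b) j)) + xr b :> R.
  move=> bT jT xb xj; rewrite -flip_star => pS.
  have sjT : star j \in barset T by rewrite in_barset_star.
  have := hw _ pS; rewrite !sum_flip2 ?bstar // starK xb xj (xstar b xb) (xstar j xj) /=.
  rewrite -!/(xr _) => h.
  have : ratr (q T) - \sum_(e in barset T) xr e <= ratr (q (flip (flip T b) (star j))) -
     (\sum_(e in barset T) xr e - xr b + 0 - 0 + xr j) :> R.
    by apply: h; rewrite /=; ring.
  lra.
(* The circuit of [flip T j] has the value [p T] at j. Orthogonality provides a second index b whose
   term is no larger, and [hle] gives the reverse inequality. *)
have heq j : j \notin barset T -> x j != None -> exists b,
     [/\ b \in barset T, x b != None, p (flip (flip T b) j) != None &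
         ratr (q T) + xr j = ratr (q (flip (flip T b) j)) + xr b :> R].
  move=> jT xj.
  pose f e := tadd (x e) (tadd (circ_vec p (flip T j) e) (Some 0)).
  have jT' : j \in barset (flip T j) by rewrite in_barset_flip eqxx (negbTE jT).
  have cj : circ_vec p (flip T j) j = p T by rewrite circ_vec_flip jT' flip_flip.
  have fj : f j = Some (xr j + ratr (q T)).
    rewrite /f cj (qE _ pT) /= addr0 /xr; by case: (x j) xj.
  have [||i1 [i2 [_ _ i12 f12 fmin]]] := @min_twice_map _ (enum (Jidx n)) f (enum_uniq _).
  - apply: orth; exists (flip T j), 0; split=> //; exists j; rewrite cj; exact/eqP.
  - by exists j; rewrite ?mem_enum // fj.
  have [b bj fb] : exists2 b, b != j & tle (f b) (f j).
    have h1 : tle (f i1) (f j) by apply: fmin; rewrite mem_enum.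
    have [ij|] := eqVneq i1 j; last by exists i1.
    by exists i2; rewrite -?f12 // -ij eq_sym.
  move: fb; rewrite fj /f circ_vec_flip.
  case xb: (x b) => [xbv|] //; case: ifP => //= bT' .
  case pb: (p _) => [pbv|] //= hb.
  have bT : b \in barset T.
    move: (bT'); rewrite in_barset_flip.
    by rewrite (idx_inj_barset bT' jT') (negbTE bj) addbF.
  have pb' : p (flip (flip T b) j) != None by rewrite flipC pb.
  exists b; split=> //; first by rewrite xb.
  have := hle b j bT jT; rewrite xb => /(_ isT xj pb').
  move: hb; have := qE _ pb'; rewrite flipC pb => -[->]; rewrite [xr b]/xr xb /=; lra.
(* The affine forms whose signs must survive: the comparisons in [hle] and [heq], and those of each
   term of the polynomial with the minimal term [m]. *)
pose c (k : Jidx n * Jidx n + 'I_(size Q)) : rat := match k with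
  | inl (b, j) => q (flip (flip T b) j) - q T
  | inr i => vq (nth m Q i).1 - vq m.1 end.
pose a (k : Jidx n * Jidx n + 'I_(size Q)) e : rat := match k with
  | inl (b, j) => (e == b)%:R - (e == j)%:R
  | inr i => ((nth m Q i).2 e)%:R - (m.2 e)%:R end.
have [y hy] := rational_solution xr c a.
have hy1 b j : let S := flip (flip T b) j in
    (ratr (q T) + xr j <= ratr (q S) + xr b :> R -> q T + y j <= q S + y b) /\
    (ratr (q T) + xr j = ratr (q S) + xr b :> R -> q T + y j = q S + y b).
  have [/= h1 h2] := hy (inl (b, j)).
  have e1 : \sum_e ratr ((e == b)%:R - (e == j)%:R) * xr e = xr b - xr j.
    rewrite -[xr b in RHS](sum_pred1 b xr) -(sum_pred1 j xr) -sumrB.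
    by apply: eq_bigr => e _; rewrite rmorphB /= !ratr_nat mulrBl.
  have e2 : \sum_e ((e == b)%:R - (e == j)%:R) * y e = y b - y j.
    rewrite -[y b in RHS](sum_pred1 b y) -(sum_pred1 j y) -sumrB.
    by apply: eq_bigr => e _; rewrite mulrBl.
  move: h1 h2; rewrite e1 e2 rmorphB /= => h1 h2.
  have h3 : ratr (q T) + xr j = ratr (q (flip (flip T b) j)) + xr b :> R ->
      q T + y j = q (flip (flip T b) j) + y b.
    move=> h; have /eqP z : q (flip (flip T b) j) - q T + (y b - y j) == 0.
      by rewrite -h2; apply/eqP; lra.
    lra.
  split=> //; rewrite le_eqVlt => /orP[/eqP/h3 ->//|h]; apply: ltW.
  suff : 0 < q (flip (flip T b) j) - q T + (y b - y j) by lra.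
  by rewrite -h1; lra.
have [||u [Uu hu]] := @lift_cocycle n U J A anti rep x y T q adm pT qE hnone.
- by move=> b j bT jT xb xj pS; apply: (hy1 b j).1; apply: hle.
- move=> j jT xj; have [b [bT xb pS e]] := heq j jT xj.
  by exists b; split=> //; apply: (hy1 b j).2.
pose G (t : pser * {ffun Jidx n -> nat}) : pser := t.1 * \prod_j u j ^+ t.2 j.
pose vt (t : pser * {ffun Jidx n -> nat}) := vq t.1 + \sum_j (t.2 j)%:R * y j.
have GE t : if finite_term x t then has_val (G t) (vt t) else G t = 0.
  exact: term_val hu (hvq t.1).
have tE t := trop_termE x (hvq t.1).
have vanG : \sum_(t <- Q) G t = 0.
  by apply: ps_inj; rewrite -evalK_lift -PQ vanish.
move: mv; rewrite tE; case: ifP => // fm [mv].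
(* Every other surviving term has strictly larger valuation at [u], so nothing cancels the leading
   coefficient of the term [m]. *)
have Gm : (\sum_(t <- Q) G t) (vt m) = G m (vt m).
  rewrite ps_coef_sum (bigD1_seq m) // big1_seq; first exact: addr0.
  move=> t /andP[tm tQ]; apply/eqP; apply: contrapT => /negP Gt.
  move: (GE t); case: ifP => [ft|_ Gt0]; last by rewrite Gt0 eqxx in Gt.
  move=> [_ /(_ _ Gt)]; apply/negP; rewrite -ltNge.
  have := mmin t _ tQ tm; rewrite tE ft => /(_ _ erefl) vlt.
  have hi : (index t Q < size Q)%N by rewrite index_mem.
  have [/= h1 _] := hy (inr (Ordinal hi)); move: h1; rewrite nth_index //.
  have e1 : \sum_e ratr ((t.2 e)%:R - (m.2 e)%:R) * xr e =
      \sum_e (t.2 e)%:R * xr e - \sum_e (m.2 e)%:R * xr e.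
    by rewrite -sumrB; apply: eq_bigr => e _; rewrite rmorphB /= !ratr_nat mulrBl.
  have e2 : \sum_e ((t.2 e)%:R - (m.2 e)%:R) * y e =
      \sum_e (t.2 e)%:R * y e - \sum_e (m.2 e)%:R * y e.
    by rewrite -sumrB; apply: eq_bigr => e _; rewrite mulrBl.
  rewrite e1 e2 rmorphB /= => h1.
  suff : 0 < vq t.1 - vq m.1 +
     (\sum_e (t.2 e)%:R * y e - \sum_e (m.2 e)%:R * y e) by rewrite /vt; lra.
  by rewrite -h1; move: vlt; rewrite -mv /xr; lra.
by move: (GE m); rewrite fm => -[]; rewrite -Gm vanG eqxx.
Qed.
End CocycleTropical.

Theorem theorem7p5 (n : nat) (U : vecK n -> Prop) (J : {set 'I_n})
    (A : 'I_n -> 'I_n -> Kt) :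
  has_dim U n -> totally_isotropic U -> wick_rep U J A ->
  forall x : Jidx n -> trop,
    (tropicalization U x /\ admissible x) <-> cocycle_space (wickval A J) x.
Proof.
move=> _ iso [[pA skewA] rep] x.
pose B i j := Pser (pA i j).
have AB : A = fun i j => ps_fun (B i j) by [].
have anti i j : B i j = - B j i by apply: ps_inj; rewrite -[LHS]/(A i j) skewA.
rewrite AB in rep *; split=> [[tx adm]|cx].
  by split=> // c; apply: (tropicalization_orth anti rep iso tx).
by split; [apply: (cocycle_tropicalization anti rep cx)|case: cx].
Qed.
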